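(* For every $n\in\mathbb N$, let $\Sigma_{n,n}$ be the $n\times n$ matrix and $\Sigma_{n,n+1}$ the $n\times(n+1)$ matrix whose $(i,j)$ entry is $1$ if $j\in\{i,i+1\}$ and $0$ otherwise. Then \[\|\Sigma_{n,n}\|_\bullet=\|\Sigma_{n,n+1}\|_\bullet=\frac{2}{n+1}\cot\Big(\frac{\pi}{2(n+1)}\Big).\]
   Context: Fix $\mathbb F\in\{\mathbb R,\mathbb C\}$. For an $m\times n$ matrix $A$ with entries in $\mathbb F$, the Schur norm is $\|A\|_\bullet=\sup\{\|A\bullet X\|: X\in M_{m,n}(\mathbb F),\ \|X\|\le1\}$, where $A\bullet X=[a_{ij}x_{ij}]$ is the entrywise product and $\|\cdot\|$ is the operator norm $\ell^2_n\to\ell^2_m$. *)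

(* Defs.v *)
From HB Require Import structures.
From mathcomp Require Import all_boot all_order all_algebra.
From mathcomp Require Import all_classical all_reals.
From mathcomp Require Import trigo.
From mathcomp Require Import complex.
Set Implicit Arguments. Unset Strict Implicit. Unset Printing Implicit Defensive.
Import Order.TTheory GRing.Theory Num.Theory.
Local Open Scope ring_scope.
Local Open Scope classical_set_scope.

Section Norms.
Variables (R : realType) (F : nzRingType) (modulus : F -> R).

Definition vnorm2 n (v : 'cV[F]_n) : R :=
  Num.sqrt (\sum_(j < n) modulus (v j 0) ^+ 2).

Definition opnorm m n (X : 'M[F]_(m, n)) : R :=
  sup [set r | exists v : 'cV[F]_n, vnorm2 v <= 1 /\ r = vnorm2 (X *m v)].

Definition schur_prod m n (A X : 'M[F]_(m, n)) : 'M[F]_(m, n) :=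
  \matrix_(i, j) (A i j * X i j).

Definition schur_norm m n (A : 'M[F]_(m, n)) : R :=
  sup [set r | exists X : 'M[F]_(m, n), opnorm X <= 1 /\ r = opnorm (schur_prod A X)].

End Norms.

(* The matrix Sigma_{m,p}: (i,j) entry is 1 if j \in {i, i+1}, else 0 (0-based indices,
   equivalent to the 1-based convention of the paper). *)
Definition Sigma (F : nzRingType) m p : 'M[F]_(m, p) :=
  \matrix_(i < m, j < p) (((j == i :> nat) || (j == i.+1 :> nat))%:R : F).

Definition schur_normR (R : realType) m n (A : 'M[R]_(m, n)) : R :=
  schur_norm (fun x : R => `|x|) A.
Definition schur_normC (R : realType) m n (A : 'M[R[i]]_(m, n)) : R :=
  schur_norm (@Normc.normc R) A.

(* Main.v *)
Require Import Defs.
From HB Require Import structures.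
From mathcomp Require Import all_boot all_order all_algebra.
From mathcomp Require Import all_classical all_reals.
From mathcomp Require Import trigo.
From mathcomp Require Import complex.
From mathcomp Require Import ring lra.
Import Order.TTheory GRing.Theory Num.Theory.
Local Open Scope ring_scope.

(** Put [M = n + 1].  Differences [d = j - i] of column and row indices lie in
    [[-(n-1), n]], where [d = 0] and [d = 1] are the only residues [0, 1] mod [M].
    Fourier inversion on the characters with frequencies [pi + 2 pi k / M] hence gives
      [Sigma_ij = (2/M) sum_k sin(pi k/M) (-1)^(d-1) sin((2d-1) pi k/M)],
    and each summand is, by the subtraction formula, an inner product of unit vectors
    of [R^2] depending on [i] and on [j].  The Cauchy-Schwarz inequality bounds the
    Schur norm by the total weight [(2/M) sum_k sin(pi k/M) = (2/M) cot(pi/2M)].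

    For the lower bound, equality in Cauchy-Schwarz determines unit vectors
    [xi_j^2 ~ s(j) s(j-1/2)], [eta_i^2 ~ s(i) s(i+1/2)], where [s(y) = sin(pi y/M)] and
    indices start at 1, and the real Cauchy-like matrix
      [X_ij = (-1)^(i+j)/M sqrt(s(i)/s(i+1/2)) sqrt(s(j)/s(j-1/2)) / s(i-j+1/2)].
    Its rows are orthonormal, by partial fractions and the values of the sums of
    [cot] and [1/sin^2] over half-integer points, and
    [<(Sigma . X) xi, eta> = (2/M) cot(pi/2M)]. *)

(** * Trigonometric sums over equidistant points *)

Lemma sin_mul_sin (R : realType) (x y : R) :
  sin x * sin y = (cos (x - y) - cos (x + y)) / 2.
Proof. by rewrite cosB cosD; field. Qed.

Section EquidistantSums.
Variables (R : realType) (n : nat).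
Implicit Types x y a b c h : R.

Let q : R := pi / n.+1%:R.

Lemma angle_step_gt0 : 0 < q.
Proof. by rewrite divr_gt0 ?pi_gt0 // ltr0n. Qed.

Lemma sin_step_gt0 x : 0 < x -> x < n.+1%:R -> 0 < sin (x * q).
Proof.
move=> x0 xM; apply: sin_gt0_pi; rewrite mulr_gt0 ?angle_step_gt0 //=.
by rewrite mulrC /q mulrAC ltr_pdivrMr ?ltr0n // ltr_pM2l // pi_gt0.
Qed.

Lemma mulSn_step : n.+1%:R * q = pi.
Proof. by rewrite mulrC divfK // pnatr_eq0. Qed.

(** Telescoping, by [2 cos z sin y = sin (z + y) - sin (z - y)]. *)
Lemma sum_cos_arith N x y :
  (\sum_(k < N) cos (x + k%:R * (2 * y))) * (2 * sin y) =
  sin (x + N%:R * (2 * y) - y) - sin (x - y).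
Proof.
elim: N => [|N IH]; first by rewrite big_ord0 !mul0r addr0 subrr.
rewrite big_ord_recr /= mulrDl IH.
set z := x + N%:R * (2 * y).
have -> : x + N.+1%:R * (2 * y) - y = z + y by rewrite /z -natr1; ring.
by rewrite (sinD z y) (sinB z y); ring.
Qed.

(** The telescoped end angles differ by [2 pi m], while [0 < m < n.+1] keeps [sin (m q)] nonzero. *)
Lemma sum_cos_period m x : (0 < m < n.+1)%N ->
  \sum_(k < n.+1) cos (x + k%:R * (2 * (m%:R * q))) = 0.
Proof.
move=> /andP[m0 mM].
have s0 : 0 < sin (m%:R * q) by rewrite sin_step_gt0 ?ltr0n ?ltr_nat.
have := sum_cos_arith n.+1 x (m%:R * q).
have -> : x + n.+1%:R * (2 * (m%:R * q)) - m%:R * q =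
   x - m%:R * q + pi *+ 2 *+ m.
  by rewrite -mulSn_step -(mulr_natl _ m) -(mulr_natl _ 2); ring.
rewrite (periodicn (@sinD2pi R)) subrr => /eqP.
rewrite mulf_eq0 => /orP[/eqP //|].
by rewrite mulf_eq0 pnatr_eq0 /= gt_eqF.
Qed.

Lemma sum_cos_multiples m : (m < n.+1)%N ->
  \sum_(k < n.+1) cos (2 * m%:R * (k%:R * q)) =
  if m == 0%N then n.+1%:R else 0.
Proof.
case: m => [_|m mM] /=.
  under eq_bigr do rewrite mulr0 mul0r cos0.
  by rewrite sumr_const card_ord.
rewrite -[RHS](sum_cos_period m.+1 0) //; apply: eq_bigr => k _.
by congr cos; ring.
Qed.

(** In the product-to-sum formula the [x + y] part is a full-period cosine sum with [m = 1], whence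
    [0 < n]. *)
Lemma sum_sin_sin x y : (0 < n)%N ->
  \sum_(k < n.+1) sin (x + k%:R * q) * sin (y + k%:R * q) =
  n.+1%:R / 2 * cos (x - y).
Proof.
move=> n0.
under eq_bigr => k _.
  have -> : sin (x + k%:R * q) * sin (y + k%:R * q) =
     (cos (x - y) - cos (x + y + k%:R * (2 * (1%:R * q)))) / 2.
    rewrite sin_mul_sin; congr ((cos _ - cos _) / 2); ring.
  over.
rewrite -mulr_suml big_split /= sumrN sum_cos_period ?ltnS ?n0 //.
by rewrite sumr_const card_ord -[_ *+ _]mulr_natl; ring.
Qed.

Lemma sum_sin_step :
  \sum_(k < n.+1) sin (k%:R * q) = cos (q / 2) / sin (q / 2).
Proof.
have s0 : 0 < sin (q / 2).
  rewrite mulrC sin_step_gt0 ?invr_gt0 //.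
  have : 1 <= n.+1%:R :> R by rewrite ler1n. lra.
have tel N : (\sum_(k < N) sin (k%:R * q)) * (2 * sin (q / 2)) =
    cos (q / 2) - cos (N%:R * q - q / 2).
  elim: N => [|N IH]; first by rewrite big_ord0 !mul0r sub0r cosN subrr.
  rewrite big_ord_recr /= mulrDl IH.
  have -> : N.+1%:R * q - q / 2 = N%:R * q + q / 2 by rewrite -natr1; field.
  by rewrite cosB cosD; ring.
have := tel n.+1; rewrite mulSn_step cosB cospi sinpi => e.
apply: (mulIf (x := 2 * sin (q / 2))).
  by rewrite mulf_neq0 ?pnatr_eq0 // gt_eqF.
by rewrite e; field; rewrite gt_eqF.
Qed.

(** Shifting by one step moves a single term by a full period. *)
Lemma sum_periodic_shift (f : R -> R) x (j : nat) : periodic f pi ->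
  \sum_(i < n.+1) f (x + i%:R * q - j%:R * q) =
  \sum_(i < n.+1) f (x + i%:R * q).
Proof.
move=> fpi; elim: j => [|j IH].
  by under eq_bigr do rewrite mul0r subr0.
rewrite -IH big_ord_recl [RHS]big_ord_recr addrC /=; congr (_ + _).
  apply: eq_bigr => i _; congr f.
  by rewrite /bump /= add1n -!(natr1 j) -(natr1 i); ring.
rewrite -fpi -mulSn_step; congr f.
by rewrite -!natr1; ring.
Qed.

Lemma sin_half_step_neq0 (i : 'I_n.+1) : sin (q / 2 + i%:R * q) != 0.
Proof.
rewrite gt_eqF // [q / 2]mulrC -mulrDl sin_step_gt0 //.
  by rewrite ltr_pwDl ?invr_gt0 ?ler0n.
have : i%:R + 1 <= n.+1%:R :> R by rewrite natr1 ler_nat.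
lra.
Qed.

Let cot x := cos x / sin x.

Lemma cotDpi x : cot (x + pi) = cot x.
Proof. by rewrite /cot sinDpi cosDpi invrN mulrNN. Qed.

(** Once the shift is removed, the reflection [a -> pi - a] permutes the points and negates
    [cot]. *)
Lemma sum_cot_half_step (j : nat) :
  \sum_(i < n.+1) cot (q / 2 + i%:R * q - j%:R * q) = 0.
Proof.
rewrite (sum_periodic_shift _ _ _ cotDpi).
suff e : \sum_(i < n.+1) cot (q / 2 + i%:R * q) =
    - \sum_(i < n.+1) cot (q / 2 + i%:R * q) by lra.
rewrite [LHS](reindex_inj rev_ord_inj) -sumrN; apply: eq_bigr => i _ /=.
have -> : q / 2 + (n.+1 - i.+1)%:R * q = - (q / 2 + i%:R * q) + pi.
  rewrite natrB ?ltn_ord // -mulSn_step -(natr1 i); by field.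
by rewrite cotDpi /cot cosN sinN invrN mulrN.
Qed.

(** Consecutive numerators differ by [2 cos (2 (p+1) a) sin a], and these cosines cancel over the
    points. *)
Lemma sum_dirichlet (p : nat) : (p < n.+1)%N ->
  \sum_(i < n.+1) sin (p.*2.+1%:R * (q / 2 + i%:R * q))
      / sin (q / 2 + i%:R * q) = n.+1%:R.
Proof.
elim: p => [_|p IH pM].
  under eq_bigr => i _ do rewrite mul1r divff ?sin_half_step_neq0 //.
  by rewrite sumr_const card_ord.
rewrite -(IH (ltnW pM)).
rewrite -[RHS]addr0 -[X in _ = _ + X](mulr0 2).
rewrite -[X in _ = _ + _ * X](sum_cos_period p.+1 (p.+1%:R * q)) ?pM //.
rewrite mulr_sumr -big_split /=.
apply: eq_bigr => i _; set a := q / 2 + i%:R * q.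
have -> : p.+1%:R * q + i%:R * (2 * (p.+1%:R * q)) = 2 * p.+1%:R * a.
  by rewrite /a; field.
set z := 2 * p.+1%:R * a.
have -> : p.+1.*2.+1%:R * a = z + a.
  by rewrite /z -natr1 -mul2n natrM; ring.
have -> : p.*2.+1%:R * a = z - a.
  by rewrite /z -natr1 -mul2n natrM -(natr1 p); ring.
rewrite sinD sinB; field; exact: sin_half_step_neq0.
Qed.

(* The Fejer kernel [(sin (N a) / sin a)^2] is a sum of Dirichlet kernels. *)
Lemma sum_csc2_half_step (j : nat) :
  \sum_(i < n.+1) (sin (q / 2 + i%:R * q - j%:R * q) ^+ 2)^-1 = n.+1%:R ^+ 2.
Proof.
rewrite (sum_periodic_shift (fun x => (sin x ^+ 2)^-1)); last first.
  by move=> x; rewrite sinDpi sqrrN.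
transitivity (\sum_(i < n.+1) \sum_(p < n.+1)
  sin (p.*2.+1%:R * (q / 2 + i%:R * q)) / sin (q / 2 + i%:R * q)).
  apply: eq_bigr => i _; set a := q / 2 + i%:R * q.
  have a0 : sin a != 0 := sin_half_step_neq0 i.
  have fejer N : (\sum_(p < N) sin (p.*2.+1%:R * a)) * sin a = sin (N%:R * a) ^+ 2.
    elim: N => [|N IH]; first by rewrite big_ord0 !mul0r sin0 expr0n.
    rewrite big_ord_recr /= mulrDl IH.
    have -> : N.*2.+1%:R * a = N%:R * a + N%:R * a + a.
      by rewrite -natr1 -addnn natrD; ring.
    rewrite -natr1 !mulrDl mul1r.
    set z := N%:R * a; rewrite (sinD (z + z) a) (sinD z z) (sinD z a) (cosD z z).
    have e : sin z ^+ 2 = sin z ^+ 2 * (cos a ^+ 2 + sin a ^+ 2).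
      by rewrite cos2Dsin2 mulr1.
    by rewrite [X in X + _ = _]e; ring.
  (* At the half-integer points [sin (n.+1 a)] is a sign, so the Fejer kernel with [N = n.+1] equals
     [1 / sin^2 a]. *)
  have sM : sin (n.+1%:R * a) ^+ 2 = 1.
    have -> : n.+1%:R * a = pi / 2 + pi *+ i.
      by rewrite /a -mulSn_step -(mulr_natl _ i); ring.
    by rewrite (alternatingn (@sinDpi R)) sin_pihalf mulr1 sqrr_sign.
  rewrite -mulr_suml; apply: (mulIf (expf_neq0 2 a0)).
  rewrite mulVf ?expf_neq0 // -[LHS]sM -fejer.
  by move: (\sum_(p < _) _) => S; field.
rewrite exchange_big /=.
under eq_bigr => p _ do rewrite sum_dirichlet //.
by rewrite sumr_const card_ord -[_ *+ _]mulr_natl -expr2.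
Qed.

End EquidistantSums.
(** * Schur norms of real matrices over a field with a modulus *)

(** Lagrange's identity: the double sum of squares is twice the gap between the two sides. *)
Lemma cauchy_schwarz_sum (R : realType) (T : finType) (a b : T -> R) :
  (\sum_t a t * b t) ^+ 2 <= (\sum_t a t ^+ 2) * (\sum_t b t ^+ 2).
Proof.
have : 0 <= \sum_s \sum_t (a s * b t - a t * b s) ^+ 2.
  by do 2![apply: sumr_ge0 => ? _]; exact: sqr_ge0.
suff -> : \sum_s \sum_t (a s * b t - a t * b s) ^+ 2 =
    2 * ((\sum_t a t ^+ 2) * (\sum_t b t ^+ 2)) - 2 * (\sum_t a t * b t) ^+ 2.
  lra.
transitivity (\sum_s \sum_t (a s ^+ 2 * b t ^+ 2 + b s ^+ 2 * a t ^+ 2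
    - 2 * (a s * b s * (a t * b t)))).
  by do 2![apply: eq_bigr => ? _]; ring.
under eq_bigr do rewrite big_split big_split /= sumrN -!mulr_sumr.
rewrite big_split big_split /= sumrN -mulr_sumr -!mulr_suml.
ring.
Qed.

Section SchurNorm.
Variables (R : realType) (F : comNzRingType) (modulus : F -> R).
(** Treats both fields at once: [e] embeds the reals, and [re], [im] are real-linear coordinates
    that determine the modulus. *)
Variables (e : {rmorphism R -> F}) (re im : {additive F -> R}).
Hypothesis modulus_ge0 : forall x, 0 <= modulus x.
Hypothesis modulus1 : modulus 1 = 1.
Hypothesis modulusM : forall x y, modulus (x * y) = modulus x * modulus y.
Hypothesis modulusD : forall x y, modulus (x + y) <= modulus x + modulus y.
Hypothesis sqr_modulus : forall x, modulus x ^+ 2 = re x ^+ 2 + im x ^+ 2.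
Hypothesis reM : forall r x, re (e r * x) = r * re x.
Hypothesis imM : forall r x, im (e r * x) = r * im x.

Local Notation vnorm2 := (vnorm2 modulus).
Local Notation opnorm := (opnorm modulus).
Local Notation schur_norm := (schur_norm modulus).

Let N2 n (v : 'cV[F]_n) := \sum_(j < n) modulus (v j 0) ^+ 2.

Lemma sqnorm_ge0 n (v : 'cV[F]_n) : 0 <= N2 n v.
Proof. by apply: sumr_ge0 => j _; exact: sqr_ge0. Qed.

Lemma modulus0 : modulus 0 = 0.
Proof.
by apply/eqP; rewrite -sqrf_eq0 sqr_modulus !raddf0 expr0n addr0.
Qed.

Lemma modulus_realM r x : modulus (e r * x) ^+ 2 = r ^+ 2 * modulus x ^+ 2.
Proof. by rewrite !sqr_modulus reM imM; ring. Qed.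

Lemma modulus_sum (T : finType) (f : T -> F) :
  modulus (\sum_t f t) <= \sum_t modulus (f t).
Proof.
elim/big_ind2: _ => [|x1 x2 y1 y2 h1 h2|//]; first by rewrite modulus0.
by rewrite (le_trans (modulusD _ _)) // lerD.
Qed.

(** Cauchy-Schwarz in each row. This crude bound makes the set behind [opnorm] bounded, so that its
    [sup] dominates its members. *)
Lemma sqnorm_mulmx_le_frobenius m n (X : 'M[F]_(m, n)) (v : 'cV[F]_n) :
  N2 m (X *m v) <= (\sum_i \sum_j modulus (X i j) ^+ 2) * N2 n v.
Proof.
rewrite mulr_suml; apply: ler_sum => i _; rewrite mxE.
apply: le_trans (cauchy_schwarz_sum _ _ _ _).
rewrite ler_sqr ?nnegrE ?modulus_ge0 //; last first.
  by apply: sumr_ge0 => j _; rewrite mulr_ge0 ?modulus_ge0.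
apply: le_trans (modulus_sum _ _) _.
by apply: ler_sum => j _; rewrite modulusM.
Qed.

Lemma vnorm2_le1 n (v : 'cV[F]_n) : (vnorm2 v <= 1) = (N2 n v <= 1).
Proof. by rewrite /Defs.vnorm2 -{1}(@sqrtr1 R) ler_sqrt. Qed.

Lemma vnorm2_0 n : vnorm2 (0 : 'cV[F]_n) = 0.
Proof.
rewrite /Defs.vnorm2 big1 ?sqrtr0 // => j _.
by rewrite mxE modulus0 expr0n.
Qed.

Lemma opnorm_leP m n (X : 'M[F]_(m, n)) C : 0 <= C ->
  (forall v, N2 m (X *m v) <= C ^+ 2 * N2 n v) -> opnorm X <= C.
Proof.
move=> C0 XC; apply: ge_sup.
  by exists (vnorm2 (X *m 0)), 0; rewrite vnorm2_0 ler01.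
move=> _ [v [v1 ->]]; rewrite -[C]ger0_norm // -sqrtr_sqr.
rewrite /Defs.vnorm2 ler_sqrt ?sqr_ge0 //.
rewrite (le_trans (XC v)) // ler_piMr ?sqr_ge0 //.
by rewrite -vnorm2_le1.
Qed.

Lemma vnorm2_le_opnorm m n (X : 'M[F]_(m, n)) v : N2 n v <= 1 ->
  vnorm2 (X *m v) <= opnorm X.
Proof.
move=> v1; apply: ub_le_sup; last by exists v; rewrite vnorm2_le1.
exists (Num.sqrt (\sum_i \sum_j modulus (X i j) ^+ 2)) => _ [w [w1 ->]].
rewrite ler_sqrt; last by do 2![apply: sumr_ge0 => ? _]; exact: sqr_ge0.
rewrite (le_trans (sqnorm_mulmx_le_frobenius _ _ _ _)) // ler_piMr -?vnorm2_le1 //.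
by do 2![apply: sumr_ge0 => ? _]; exact: sqr_ge0.
Qed.

(** By rescaling to a unit vector; a vector of norm zero is left to the Frobenius bound. *)
Lemma sqnorm_mulmx_contraction m n (X : 'M[F]_(m, n)) v : opnorm X <= 1 ->
  N2 m (X *m v) <= N2 n v.
Proof.
move=> X1; have [v0|v0] := eqVneq (N2 n v) 0.
  by rewrite (le_trans (sqnorm_mulmx_le_frobenius _ _ _ _)) // v0 mulr0.
have vp : 0 < N2 n v by rewrite lt_def v0 sqnorm_ge0.
set r := (Num.sqrt (N2 n v))^-1.
have r2 : r ^+ 2 = (N2 n v)^-1 by rewrite exprVn sqr_sqrtr // ltW.
have scale k (w : 'cV[F]_k) : N2 k (e r *: w) = r ^+ 2 * N2 k w.
  by rewrite mulr_sumr; apply: eq_bigr => j _; rewrite mxE modulus_realM.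
have : vnorm2 (X *m (e r *: v)) <= 1.
  by apply: le_trans X1; apply: vnorm2_le_opnorm; rewrite scale r2 mulVf.
by rewrite vnorm2_le1 -scalemxAr scale r2 mulrC ler_pdivrMr // mul1r.
Qed.

(** For real [r] and [z = X r], one has [0 <= |r - X^T z|^2 = |r|^2 - |z|^2]. As [X] is real, this
    applies to [re] and [im] separately. *)
Lemma opnorm_coisometry_le1 m n (X : 'M[R]_(m, n)) : X *m X^T = 1%:M ->
  opnorm (map_mx e X) <= 1.
Proof.
move=> XX.
have contr (r : 'I_n -> R) :
    \sum_i (\sum_j X i j * r j) ^+ 2 <= \sum_j r j ^+ 2.
  pose z i := \sum_j X i j * r j.
  have zX : \sum_j r j * (\sum_i X i j * z i) = \sum_i z i ^+ 2.
    transitivity (\sum_j \sum_i z i * (X i j * r j)).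
      by apply: eq_bigr => j _; rewrite mulr_sumr; apply: eq_bigr => i _; ring.
    rewrite exchange_big /=; apply: eq_bigr => i _.
    by rewrite -mulr_sumr -expr2.
  have XXz : \sum_j (\sum_i X i j * z i) ^+ 2 = \sum_i z i ^+ 2.
    transitivity (\sum_j \sum_i \sum_k z i * z k * (X i j * X k j)).
      apply: eq_bigr => j _; rewrite expr2 mulr_suml; apply: eq_bigr => i _.
      by rewrite mulr_sumr; apply: eq_bigr => k _; ring.
    rewrite exchange_big /=; apply: eq_bigr => i _.
    rewrite exchange_big /= (bigD1 i) //= [X in _ + X]big1 ?addr0.
      rewrite -mulr_sumr; have /matrixP/(_ i i) := XX.
      rewrite !mxE eqxx; under eq_bigr do rewrite mxE.
      by move=> ->; rewrite mulr1 expr2.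
    move=> k ki; rewrite -mulr_sumr; have /matrixP/(_ i k) := XX.
    rewrite !mxE eq_sym (negbTE ki); under eq_bigr do rewrite mxE.
    by move=> ->; rewrite mulr0.
  have : 0 <= \sum_j (r j - \sum_i X i j * z i) ^+ 2.
    by apply: sumr_ge0 => j _; exact: sqr_ge0.
  under eq_bigr => j _.
    rewrite sqrrB -mulr_natl; over.
  rewrite !big_split /= sumrN -mulr_sumr zX XXz -/z; lra.
apply: opnorm_leP => // w; rewrite expr1n mul1r /N2.
have XE (f : {additive F -> R}) i : (forall r x, f (e r * x) = r * f x) ->
    f ((map_mx e X *m w) i 0) = \sum_j X i j * f (w j 0).
  by move=> fM; rewrite mxE raddf_sum; apply: eq_bigr => j _; rewrite mxE fM.
under eq_bigr do rewrite sqr_modulus !XE //.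
under [X in _ <= X]eq_bigr do rewrite sqr_modulus.
by rewrite !big_split lerD.
Qed.

(** * Bounds on the Schur norm from a factorization *)

Section Bound.
Variables (m n : nat) (A : 'M[R]_(m, n)) (c : R).
Variables (T : finType) (u : 'I_m -> T -> R) (v : 'I_n -> T -> R).
Hypothesis Auv : forall i j, A i j = \sum_t u i t * v j t.
Hypothesis u_le : forall i, \sum_t u i t ^+ 2 <= c.
Hypothesis v_le : forall j, \sum_t v j t ^+ 2 <= c.
Hypothesis c_ge0 : 0 <= c.

(** With [y t] the entrywise product of [v _ t] and [w], coordinate [i] of the image is the sum over
    [t] of [u i t * (X *m y t) i 0]. Cauchy-Schwarz in [t] costs one factor [c], contractivity
    replaces [X *m y t] by [y t], and the bound on [v] costs the other [c]. *)
Lemma opnorm_schur_prod_le (X : 'M[F]_(m, n)) : opnorm X <= 1 ->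
  opnorm (schur_prod (map_mx e A) X) <= c.
Proof.
move=> X1; apply: opnorm_leP => // w.
pose y t : 'cV[F]_n := \col_j (e (v j t) * w j 0).
have yE (f : {additive F -> R}) i : (forall r x, f (e r * x) = r * f x) ->
    f ((schur_prod (map_mx e A) X *m w) i 0) =
    \sum_t u i t * f ((X *m y t) i 0).
  move=> fM; rewrite mxE raddf_sum /=.
  transitivity (\sum_j \sum_t u i t * f (X i j * y t j 0)).
    apply: eq_bigr => j _; rewrite !mxE -mulrA fM Auv mulr_suml.
    apply: eq_bigr => t _; rewrite mxE mulrCA fM; ring.
  rewrite exchange_big /=; apply: eq_bigr => t _.
  by rewrite mxE raddf_sum /= mulr_sumr.
have step1 : N2 m (schur_prod (map_mx e A) X *m w) <= \sum_t c * N2 m (X *m y t).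
  rewrite -mulr_sumr exchange_big /= mulr_sumr; apply: ler_sum => i _.
  rewrite sqr_modulus !yE //.
  under [X in _ <= c * X]eq_bigr do rewrite sqr_modulus.
  rewrite big_split /= mulrDr.
  by apply: lerD; apply: le_trans (cauchy_schwarz_sum _ _ _ _) _;
    rewrite ler_wpM2r ?u_le //; apply: sumr_ge0 => t _; exact: sqr_ge0.
apply: le_trans step1 _; rewrite -mulr_sumr expr2 -mulrA ler_wpM2l //.
apply: (@le_trans _ _ (\sum_t N2 n (y t))).
  by apply: ler_sum => t _; exact: sqnorm_mulmx_contraction.
rewrite exchange_big /= mulr_sumr; apply: ler_sum => j _.
under eq_bigr do rewrite mxE modulus_realM.
by rewrite -mulr_suml ler_wpM2r ?sqr_ge0 ?v_le.
Qed.

Lemma schur_norm_le : schur_norm (map_mx e A) <= c.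
Proof.
apply: ge_sup; last by move=> _ [X [X1 ->]]; exact: opnorm_schur_prod_le.
exists (opnorm (schur_prod (map_mx e A) 0)), 0; split => //.
apply: opnorm_leP => // w; rewrite mul0mx expr1n mul1r /N2 big1 ?sqnorm_ge0 //.
by move=> i _; rewrite mxE modulus0 expr0n.
Qed.

(** The factorization enters here too: it bounds the set whose [sup] is the Schur norm. *)
Lemma le_schur_norm (X : 'M[F]_(m, n)) : opnorm X <= 1 ->
  opnorm (schur_prod (map_mx e A) X) <= schur_norm (map_mx e A).
Proof.
move=> X1; apply: ub_le_sup; last by exists X.
by exists c => _ [Y [Y1 ->]]; exact: opnorm_schur_prod_le.
Qed.

(** A coisometry is an admissible test matrix, and pairing [(A . X) xi] with [eta] bounds its norm
    from below by Cauchy-Schwarz. *)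
Lemma schur_norm_ge (X : 'M[R]_(m, n)) (xi : 'I_n -> R) (eta : 'I_m -> R) d :
  X *m X^T = 1%:M -> \sum_j xi j ^+ 2 <= 1 -> \sum_i eta i ^+ 2 <= 1 ->
  0 <= d -> d <= \sum_i eta i * \sum_j A i j * X i j * xi j ->
  d <= schur_norm (map_mx e A).
Proof.
move=> XX xi1 eta1 d0 dle.
apply: le_trans (le_schur_norm _ (opnorm_coisometry_le1 _ _ _ XX)).
have modr r : modulus (e r) ^+ 2 = r ^+ 2.
  by rewrite -[e r]mulr1 modulus_realM modulus1 expr1n mulr1.
pose w : 'cV[F]_n := \col_j e (xi j).
apply: le_trans (vnorm2_le_opnorm _ _ _ w _); last first.
  by rewrite /N2; under eq_bigr do rewrite mxE modr.
rewrite -[d]ger0_norm // -sqrtr_sqr /Defs.vnorm2.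
pose y i := \sum_j A i j * X i j * xi j.
have -> : \sum_(i < m) modulus
    ((schur_prod (map_mx e A) (map_mx e X) *m w) i 0) ^+ 2 = \sum_i y i ^+ 2.
  apply: eq_bigr => i _; rewrite -[RHS]modr; congr (modulus _ ^+ 2).
  rewrite mxE rmorph_sum; apply: eq_bigr => j _.
  by rewrite !mxE !rmorphM.
have y0 : 0 <= \sum_i y i ^+ 2 by apply: sumr_ge0 => i _; exact: sqr_ge0.
rewrite ler_sqrt //; apply: (@le_trans _ _ ((\sum_i eta i * y i) ^+ 2)).
  by rewrite ler_sqr ?nnegrE // (le_trans d0).
by apply: le_trans (cauchy_schwarz_sum _ _ _ _) _; rewrite ler_piMl.
Qed.

End Bound.
End SchurNorm.
(** * The matrices [Sigma] *)

Section SigmaUpper.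
Variables (R : realType) (n p : nat).
Hypothesis p_le : (p <= n.+1)%N.

Let q : R := pi / n.+1%:R.
(** Square root of the [k]-th Fourier weight, since rows and columns each carry one factor. *)
Definition Sigma_weight (k : 'I_n.+1) : R := Num.sqrt (2 / n.+1%:R * sin (k%:R * q)).

Definition Sigma_row (i : 'I_n) (t : 'I_n.+1 * bool) : R :=
  let x := 2 * i%:R * (t.1%:R * q) in
  Sigma_weight t.1 * (-1) ^+ i * (if t.2 then cos x else sin x).

(** A quarter turn ahead of the row vectors: at angles [x] (row) and [y] (column) the inner product
    is [sin (x - y) = - sin (y - x)], whose sign turns [(-1)^d] into [(-1)^(d-1)]. *)
Definition Sigma_col (j : 'I_p) (t : 'I_n.+1 * bool) : R :=
  let x := (2 * j%:R - 1) * (t.1%:R * q) in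
  Sigma_weight t.1 * (-1) ^+ j * (if t.2 then - sin x else cos x).

Lemma sqr_Sigma_weight k : Sigma_weight k ^+ 2 = 2 / n.+1%:R * sin (k%:R * q).
Proof.
rewrite sqr_sqrtr // mulr_ge0 ?divr_ge0 ?ler0n //.
case: (posnP k) => [->|k0]; first by rewrite mul0r sin0.
by rewrite ltW // sin_step_gt0 ?ltr0n ?ltr_nat.
Qed.

Lemma sum_pair_bool (f : 'I_n.+1 * bool -> R) :
  \sum_t f t = \sum_k (f (k, true) + f (k, false)).
Proof.
rewrite (eq_bigr (fun t => f (t.1, t.2))); last by case.
rewrite -(pair_bigA _ (fun k b => f (k, b))) /=.
by apply: eq_bigr => k _; rewrite big_bool.
Qed.

Lemma sum_sqr_Sigma_weight :
  \sum_k Sigma_weight k ^+ 2 = 2 / n.+1%:R * (cos (q / 2) / sin (q / 2)).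
Proof.
rewrite -sum_sin_step mulr_sumr; apply: eq_bigr => k _; exact: sqr_Sigma_weight.
Qed.

Lemma sum_sqr_Sigma_row i :
  \sum_t Sigma_row i t ^+ 2 = 2 / n.+1%:R * (cos (q / 2) / sin (q / 2)).
Proof.
rewrite sum_pair_bool -sum_sqr_Sigma_weight; apply: eq_bigr => k _ /=.
by rewrite !exprMn sqrr_sign -mulrDr cos2Dsin2 !mulr1.
Qed.

Lemma sum_sqr_Sigma_col j :
  \sum_t Sigma_col j t ^+ 2 = 2 / n.+1%:R * (cos (q / 2) / sin (q / 2)).
Proof.
rewrite sum_pair_bool -sum_sqr_Sigma_weight; apply: eq_bigr => k _ /=.
by rewrite !exprMn sqrr_sign sqrrN -mulrDr addrC cos2Dsin2 !mulr1.
Qed.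

(** Product-to-sum leaves two cosine sums, with frequencies [i - j + 1] and [j - i]. Both have
    absolute value at most [n], so the first sum survives only for [j = i + 1] and the second only
    for [j = i]. *)
Lemma Sigma_factor i j :
  Sigma R n p i j = \sum_t Sigma_row i t * Sigma_col j t.
Proof.
rewrite sum_pair_bool mxE.
transitivity (- (-1) ^+ (i + j) / n.+1%:R *
  \sum_(k < n.+1) (cos (2 * (i%:R - j%:R + 1) * (k%:R * q))
                 - cos (2 * (j%:R - i%:R) * (k%:R * q))) : R); last first.
  rewrite mulr_sumr; apply: eq_bigr => k _ /=.
  have -> : Sigma_row i (k, true) * Sigma_col j (k, true)
      + Sigma_row i (k, false) * Sigma_col j (k, false) =
      - (-1) ^+ (i + j) * (Sigma_weight k ^+ 2 *
        sin ((2 * j%:R - 1) * (k%:R * q) - 2 * i%:R * (k%:R * q))).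
    by rewrite /Sigma_row /Sigma_col /= sinB exprD; ring.
  rewrite sqr_Sigma_weight -(mulrA (2 / n.+1%:R)) sin_mul_sin.
  set x := k%:R * q.
  have -> : x - ((2 * j%:R - 1) * x - 2 * i%:R * x) = 2 * (i%:R - j%:R + 1) * x.
    ring.
  have -> : x + ((2 * j%:R - 1) * x - 2 * i%:R * x) = 2 * (j%:R - i%:R) * x.
    ring.
  by field; rewrite nat1r pnatr_eq0.
have M0 : n.+1%:R != 0 :> R by rewrite pnatr_eq0.
rewrite sumrB; case: (ltnP i j) => ij.
  have [d jE] : exists d, j = (i + d.+1)%N :> nat.
    by exists (j - i.+1)%N; rewrite addnS -addSn subnKC.
  have jn := leq_trans (ltn_ord j) p_le.
  have dn : (d.+1 < n.+1)%N by apply: leq_ltn_trans jn; rewrite jE leq_addl.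
  have -> : i%:R - j%:R + 1 = - d%:R :> R by rewrite jE natrD -natr1; ring.
  have -> : j%:R - i%:R = d.+1%:R :> R by rewrite jE natrD; ring.
  under eq_bigr do rewrite mulrN mulNr cosN.
  rewrite !sum_cos_multiples //; last exact: ltnW.
  have -> : (j == i :> nat) || (j == i.+1 :> nat) = (d == 0%N).
    rewrite jE -[X in (_ == X) || _]addn0 -[X in _ || (_ == X)]addn1.
    by rewrite !eqn_add2l.
  case: d dn jE => [|d] _ jE /=; last by rewrite subr0 mulr0.
  have -> : (i + j = (i + i).+1)%N by rewrite jE addn1 addnS.
  by rewrite exprS addnn -signr_odd odd_double mulr1 opprK subr0 mul1r mulVf.
have [d iE] : exists d, i = (j + d)%N :> nat.
  by exists (i - j)%N; rewrite subnKC.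
have dn : (d.+1 < n.+1)%N.
  by rewrite ltnS; apply: leq_ltn_trans (ltn_ord i); rewrite iE leq_addl.
have -> : i%:R - j%:R + 1 = d.+1%:R :> R by rewrite iE natrD -natr1; ring.
have -> : j%:R - i%:R = - d%:R :> R by rewrite iE natrD; ring.
under [X in _ - X]eq_bigr do rewrite mulrN mulNr cosN.
rewrite !sum_cos_multiples //; last exact: ltnW.
have -> : (j == i :> nat) || (j == i.+1 :> nat) = (d == 0%N).
  rewrite iE -addnS -[X in (X == _) || _]addn0 -[X in _ || (X == _)]addn0.
  by rewrite !eqn_add2l orbF eq_sym.
case: d dn iE => [|d] _ iE /=; last by rewrite subr0 mulr0.
rewrite iE addn0 addnn -signr_odd odd_double expr0 sub0r.
by rewrite mulNr mulrNN mul1r mulVf.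
Qed.

End SigmaUpper.

(** * The extremal coisometry and its unit vectors *)

Lemma sin_partial_fraction (R : realType) (a b h : R) :
  sin a != 0 -> sin b != 0 -> sin (a - b) != 0 ->
  sin (a + h) / (sin a * sin (a - b)) =
  (sin (b + h) / sin (a - b) - sin h / sin a) / sin b.
Proof.
move=> a0 b0 ab0.
(* Clearing denominators leaves Ptolemy's identity for sines. *)
suff e : sin (a + h) * sin b = sin (b + h) * sin a - sin h * sin (a - b).
  by rewrite -[sin (a + h)](mulfK b0) e; field; rewrite a0 b0 ab0.
by rewrite (sinD a) (sinD b) sinB; ring.
Qed.

Lemma csc_csc_cot (R : realType) (x y : R) :
  sin x != 0 -> sin y != 0 -> sin (x - y) != 0 ->
  (sin x * sin y)^-1 = (cos y / sin y - cos x / sin x) / sin (x - y).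
Proof.
move=> x0 y0 xy0; apply: (mulIf xy0); rewrite divfK //.
by rewrite sinB; field; rewrite x0 y0.
Qed.

Section SigmaLower.
Variables (R : realType) (n : nat).

Let q : R := pi / n.+1%:R.
Let h : R := q / 2.

(** The angle is a half-integer multiple of [q] of absolute value below [pi]. *)
Lemma sin_half_shift_neq0 (j l : nat) : (j < n.+1)%N -> (l <= n.+1)%N ->
  sin (h + j%:R * q - l%:R * q) != 0.
Proof.
move=> jM lM; have [lj|jl] := leqP l j.
  rewrite -addrA -mulrBl -natrB //.
  by rewrite (@sin_half_step_neq0 R n (Ordinal (leq_ltn_trans (leq_subr l j) jM))).
have -> : h + j%:R * q - l%:R * q = - ((l%:R - j%:R - 2^-1) * q).
  by rewrite /h; field.
rewrite sinN oppr_eq0 gt_eqF // sin_step_gt0 //.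
  have : j.+1%:R <= l%:R :> R by rewrite ler_nat.
  by rewrite -natr1; lra.
have : l%:R <= n.+1%:R :> R by rewrite ler_nat.
have : 0 <= j%:R :> R := ler0n _ _.
lra.
Qed.

Lemma sin_succ_gt0 (i : nat) : (i < n)%N -> 0 < sin (i.+1%:R * q).
Proof. by move=> i_n; rewrite sin_step_gt0 ?ltr0n ?ltr_nat. Qed.

(** Up to scaling, the Gram matrix of the rows of the extremal matrix. Partial fractions split off a
    difference of cotangents, which sums to zero; the rest is a [1/sin^2] sum if [i = k] and again a
    cotangent difference otherwise. *)
Lemma sum_cauchy_kernel (i k : nat) : (i < n)%N -> (k < n)%N ->
  \sum_(j < n.+1) sin (h + j%:R * q + h) /
    (sin (h + j%:R * q) * sin (h + j%:R * q - i.+1%:R * q)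
     * sin (h + j%:R * q - k.+1%:R * q)) =
  if i == k then n.+1%:R ^+ 2 * sin (i.+1%:R * q + h) / sin (i.+1%:R * q)
  else 0.
Proof.
move=> i_n k_n.
set b := i.+1%:R * q; set c := k.+1%:R * q.
have b0 : sin b != 0 by rewrite gt_eqF // sin_succ_gt0.
have c0 : sin c != 0 by rewrite gt_eqF // sin_succ_gt0.
have a0 (j : 'I_n.+1) : sin (h + j%:R * q) != 0 := sin_half_step_neq0 _ _ j.
have ab0 (j : 'I_n.+1) : sin (h + j%:R * q - b) != 0.
  by rewrite sin_half_shift_neq0 // ltnW.
have ac0 (j : 'I_n.+1) : sin (h + j%:R * q - c) != 0.
  by rewrite sin_half_shift_neq0 // ltnW.
pose cot x : R := cos x / sin x.
have cot0 : \sum_(j < n.+1) cot (h + j%:R * q) = 0.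
  rewrite -[RHS](sum_cot_half_step R n 0); apply: eq_bigr => j _.
  by rewrite mul0r subr0.
have acE (j : 'I_n.+1) : (sin (h + j%:R * q) * sin (h + j%:R * q - c))^-1 =
    (cot (h + j%:R * q - c) - cot (h + j%:R * q)) / sin c.
  have e : h + j%:R * q - (h + j%:R * q - c) = c by ring.
  by rewrite csc_csc_cot ?e.
have pf (j : 'I_n.+1) : sin (h + j%:R * q + h) /
    (sin (h + j%:R * q) * sin (h + j%:R * q - b) * sin (h + j%:R * q - c)) =
    sin (b + h) / sin b * (sin (h + j%:R * q - b) * sin (h + j%:R * q - c))^-1
    - sin h / sin b * ((cot (h + j%:R * q - c) - cot (h + j%:R * q)) / sin c).
  rewrite -acE invfM mulrA sin_partial_fraction //.
  by field; rewrite a0 b0 ab0 ac0.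
under eq_bigr do rewrite pf.
rewrite sumrB -!mulr_sumr -mulr_suml sumrB sum_cot_half_step cot0.
rewrite subrr mul0r mulr0 subr0.
have [ik|ik] := eqVneq i k.
  rewrite /c -ik -/b.
  under eq_bigr do rewrite -expr2.
  by rewrite sum_csc2_half_step; ring.
have cb0 : sin (c - b) != 0.
  rewrite /c /b -mulrBl; case: (ltngtP i k) ik => // ik _.
    rewrite -natrB; last by rewrite ltnS ltnW.
    rewrite subSS gt_eqF // sin_step_gt0 ?ltr0n ?subn_gt0 // ltr_nat.
    by rewrite ltnS (leq_trans (leq_subr _ _)) // ltnW.
  rewrite -opprB mulNr sinN oppr_eq0 -natrB; last by rewrite ltnS ltnW.
  rewrite subSS gt_eqF // sin_step_gt0 ?ltr0n ?subn_gt0 // ltr_nat.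
  by rewrite ltnS (leq_trans (leq_subr _ _)) // ltnW.
under eq_bigr => j _.
  have e : h + j%:R * q - b - (h + j%:R * q - c) = c - b by ring.
  rewrite csc_csc_cot ?e // -!/(cot _); over.
by rewrite -mulr_suml sumrB !sum_cot_half_step subrr mul0r mulr0.
Qed.

(** Treats [p = n] and [p = n.+1] together: the term of index [n] vanishes. *)
Lemma sum_ord_truncate (p : nat) (f : nat -> R) :
  (n <= p <= n.+1)%N -> f n = 0 -> \sum_(j < p) f j = \sum_(j < n.+1) f j.
Proof.
move=> /andP[np pn] fn; move: np; rewrite leq_eqVlt => /orP[/eqP <-|np].
  by rewrite big_ord_recr /= fn addr0.
by have -> : p = n.+1 by apply/eqP; rewrite eqn_leq pn np.
Qed.

(** Indices start at 0 here, so the angle of the 1-based index is [j.+1%:R * q], and [h + j%:R * q]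
    lies half a step below it. *)
Definition col_scale (j : nat) : R := Num.sqrt (sin (j.+1%:R * q) / sin (h + j%:R * q)).
Definition row_scale (i : nat) : R :=
  Num.sqrt (sin (i.+1%:R * q) / sin (i.+1%:R * q + h)).
Definition extremal_entry (i j : nat) : R :=
  (-1) ^+ (i + j) / n.+1%:R * row_scale i * col_scale j
    / sin (i.+1%:R * q - (h + j%:R * q)).

Lemma sin_stepn : sin (n.+1%:R * q) = 0.
Proof. by rewrite mulSn_step sinpi. Qed.

Lemma sin_half_gt0 (j : nat) : (j <= n)%N -> 0 < sin (h + j%:R * q).
Proof.
move=> jn; rewrite /h [q / 2]mulrC -mulrDl sin_step_gt0 //.
  by rewrite ltr_pwDl ?invr_gt0 ?ler0n.
have : j%:R <= n%:R :> R by rewrite ler_nat.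
by rewrite -(natr1 n); lra.
Qed.

Lemma succ_step_half (i : nat) : i.+1%:R * q + h = h + i.+1%:R * q.
Proof. by rewrite addrC. Qed.

Lemma sqr_col_scale (j : nat) : (j <= n)%N ->
  col_scale j ^+ 2 = sin (j.+1%:R * q) / sin (h + j%:R * q).
Proof.
move=> jn; rewrite sqr_sqrtr // divr_ge0 //; last by rewrite ltW ?sin_half_gt0.
move: jn; rewrite leq_eqVlt => /orP[/eqP ->|jn]; first by rewrite sin_stepn.
by rewrite ltW ?sin_succ_gt0.
Qed.

Lemma sqr_row_scale (i : nat) : (i < n)%N ->
  row_scale i ^+ 2 = sin (i.+1%:R * q) / sin (i.+1%:R * q + h).
Proof.
move=> i_n; rewrite sqr_sqrtr // divr_ge0 //; first by rewrite ltW ?sin_succ_gt0.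
by rewrite succ_step_half ltW ?sin_half_gt0.
Qed.

Lemma col_scale_n : col_scale n = 0.
Proof. by rewrite /col_scale sin_stepn mul0r sqrtr0. Qed.

(* The coisometry forced by the equality case of the upper bound: it maps the
   columns of the trigonometric factorization of [Sigma], weighted by
   [extremal_col] below, to its rows weighted by [extremal_row].  Its last column
   vanishes when [p = n.+1], because [sin (n.+1%:R * q) = sin pi = 0]. *)
Definition Sigma_extremal p : 'M[R]_(n, p) := \matrix_(i, j) extremal_entry i j.

Lemma Sigma_extremal_coisometry p : (n <= p <= n.+1)%N ->
  Sigma_extremal p *m (Sigma_extremal p)^T = 1%:M.
Proof.
move=> np; apply/matrixP => i k; rewrite !mxE.
under eq_bigr do rewrite !mxE.
rewrite (sum_ord_truncate p
  (fun j => extremal_entry i j * extremal_entry k j)) //; last first.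
  by rewrite /extremal_entry col_scale_n !(mulr0, mul0r).
transitivity ((-1) ^+ (i + k) / n.+1%:R ^+ 2 * row_scale i * row_scale k *
  \sum_(j < n.+1) sin (h + j%:R * q + h) /
    (sin (h + j%:R * q) * sin (h + j%:R * q - i.+1%:R * q)
     * sin (h + j%:R * q - k.+1%:R * q))).
  rewrite mulr_sumr; apply: eq_bigr => j _.
  (* As [2 h = q], the kernel's numerator is that of the squared column scale. *)
  have -> : h + j%:R * q + h = j.+1%:R * q by rewrite /h -natr1; field.
  have sg : (-1) ^+ (i + j) * (-1) ^+ (k + j) = (-1) ^+ (i + k) :> R.
    by rewrite !exprD mulrACA -expr2 sqrr_sign mulr1.
  have r2 := sqr_col_scale j (ltn_ord j).
  transitivity ((-1) ^+ (i + j) * (-1) ^+ (k + j) / n.+1%:R ^+ 2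
    * row_scale i * row_scale k * (col_scale j ^+ 2 / (sin (h + j%:R * q - i.+1%:R * q)
     * sin (h + j%:R * q - k.+1%:R * q)))).
    rewrite /extremal_entry -!(opprB (h + j%:R * q)) !sinN.
    have iM : (i.+1 <= n.+1)%N by rewrite ltnS ltnW.
    have kM : (k.+1 <= n.+1)%N by rewrite ltnS ltnW.
    by field; rewrite nat1r pnatr_eq0 !sin_half_shift_neq0.
  by rewrite sg r2; congr (_ * _); rewrite !invfM !mulrA.
rewrite sum_cauchy_kernel // -val_eqE /=.
case: eqVneq => [ik|_]; last by rewrite mulr0.
rewrite -ik addnn -signr_odd odd_double expr0.
have t2 := sqr_row_scale i (ltn_ord i).
transitivity (row_scale i ^+ 2 * sin (i.+1%:R * q + h) / sin (i.+1%:R * q)).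
  field; rewrite nat1r pnatr_eq0 gt_eqF // sin_succ_gt0 //.
rewrite t2 mulr1n; field.
by rewrite !gt_eqF ?sin_succ_gt0 ?succ_step_half ?sin_half_gt0.
Qed.

(** Normalizing constant: the squared entries without it sum to [(n+1)/2 * cos h]. *)
Definition extremal_const : R := Num.sqrt (2 / (n.+1%:R * cos h)).
(** This is a multiple of [sqrt (s(j) s(j-1/2))], written so that products with [extremal_entry]
    contain [col_scale] only squared. *)
Definition extremal_col (j : nat) : R :=
  extremal_const * col_scale j * sin (h + j%:R * q).
Definition extremal_row (i : nat) : R :=
  extremal_const * row_scale i * sin (i.+1%:R * q + h).

(** For [n = 0] the angle [h] is [pi/2], so [cos h = 0] and the normalization breaks down. *)
Hypothesis n_gt0 : (0 < n)%N.

Lemma cos_half_step_gt0 : 0 < cos h.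
Proof.
have q0 : 0 < q := angle_step_gt0 R n.
have pq : 2 * q <= pi.
  by rewrite -(mulSn_step R n) ler_wpM2r ?ler_nat // ltW.
by apply: cos_gt0_pihalf; rewrite /h; lra.
Qed.

Lemma sqr_extremal_const : extremal_const ^+ 2 = 2 / (n.+1%:R * cos h).
Proof.
by rewrite sqr_sqrtr // divr_ge0 // mulr_ge0 // ltW ?cos_half_step_gt0.
Qed.

Lemma sum_sqr_extremal_col p : (n <= p <= n.+1)%N ->
  \sum_(j < p) extremal_col j ^+ 2 = 1.
Proof.
move=> np; rewrite (sum_ord_truncate p (fun j => extremal_col j ^+ 2)) //; last first.
  by rewrite /extremal_col col_scale_n mulr0 mul0r expr0n.
transitivity (extremal_const ^+ 2 *
    \sum_(j < n.+1) sin (q + j%:R * q) * sin (h + j%:R * q)).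
  rewrite mulr_sumr; apply: eq_bigr => j _.
  have jn : (j <= n)%N by rewrite -ltnS.
  rewrite /extremal_col (exprMn 2 _ (sin _)) (exprMn 2 extremal_const).
  rewrite (sqr_col_scale j jn).
  have -> : q + j%:R * q = j.+1%:R * q by rewrite -(natr1 j); ring.
  by field; rewrite gt_eqF ?sin_half_gt0.
rewrite sum_sin_sin // sqr_extremal_const.
have -> : q - h = h by rewrite /h; field.
by field; rewrite nat1r pnatr_eq0 gt_eqF ?cos_half_step_gt0.
Qed.

Lemma sum_sqr_extremal_row : \sum_(i < n) extremal_row i ^+ 2 = 1.
Proof.
have nn : (n <= n <= n.+1)%N by rewrite leqnn leqnSn.
transitivity (extremal_const ^+ 2 *
    \sum_(i < n) sin (q + i%:R * q) * sin (q + h + i%:R * q)).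
  rewrite mulr_sumr; apply: eq_bigr => i _.
  rewrite /extremal_row (exprMn 2 _ (sin _)) (exprMn 2 extremal_const).
  rewrite (sqr_row_scale i (ltn_ord i)).
  have -> : q + i%:R * q = i.+1%:R * q by rewrite -natr1; ring.
  have -> : q + h + i%:R * q = i.+1%:R * q + h by rewrite -natr1; ring.
  by field; rewrite succ_step_half gt_eqF ?sin_half_gt0.
rewrite (sum_ord_truncate _ (fun i => sin (q + i%:R * q) * sin (q + h + i%:R * q)))
  //; last first.
  have -> : q + n%:R * q = n.+1%:R * q by rewrite -natr1; ring.
  by rewrite sin_stepn mul0r.
rewrite sum_sin_sin // sqr_extremal_const opprD addNKr cosN.
by field; rewrite nat1r pnatr_eq0 gt_eqF ?cos_half_step_gt0.
Qed.

(** Only [j = i] and [j = i + 1] contribute, with denominators [sin h] and [- sin h]; the sign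
    [(-1)^(i+j)] makes both terms positive. Summing over [i] gives
    [(n+1)/2 * (1 + cos q) = (n+1) cos^2 h]. *)
Lemma Sigma_extremal_value p : (n <= p <= n.+1)%N ->
  \sum_(i < n) extremal_row i *
    (\sum_(j < p) Sigma R n p i j * Sigma_extremal p i j * extremal_col j)
  = 2 / n.+1%:R * (cos h / sin h).
Proof.
move=> np.
have h0 : 0 < sin h by have := sin_half_gt0 0 (leq0n n); rewrite mul0r addr0.
have extremal_entryE (i j : nat) : (i < n)%N -> (j <= n)%N ->
    extremal_row i * (extremal_entry i j * extremal_col j) =
      (-1) ^+ (i + j) * extremal_const ^+ 2 / n.+1%:R *
      sin (i.+1%:R * q) * sin (j.+1%:R * q) / sin (i.+1%:R * q - (h + j%:R * q)).
  move=> i_n jn.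
  transitivity ((-1) ^+ (i + j) * extremal_const ^+ 2 / n.+1%:R *
      (row_scale i ^+ 2 * sin (i.+1%:R * q + h))
      * (col_scale j ^+ 2 * sin (h + j%:R * q))
      / sin (i.+1%:R * q - (h + j%:R * q))).
    by rewrite /extremal_row /extremal_entry /extremal_col; ring.
  rewrite sqr_row_scale // sqr_col_scale // !divfK // gt_eqF ?sin_half_gt0 //.
  by rewrite succ_step_half sin_half_gt0.
transitivity (extremal_const ^+ 2 / (n.+1%:R * sin h) *
    \sum_(i < n) (sin (q + i%:R * q) * sin (q + i%:R * q)
      + sin (q + i%:R * q) * sin (q + q + i%:R * q))).
  rewrite mulr_sumr; apply: eq_bigr => i _.
  under eq_bigr do rewrite !mxE.
  (* With range [n.+1] the column [i.+1] exists for every row, also when [p = n]. *)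
  rewrite (sum_ord_truncate p (fun j =>
    ((j == i) || (j == i.+1))%:R * extremal_entry i j * extremal_col j))
    //; last by rewrite /extremal_col col_scale_n mulr0 mul0r mulr0.
  have iM : (i < n.+1)%N by rewrite ltnS ltnW.
  have i1M : (i.+1 < n.+1)%N := ltn_ord i.
  rewrite (bigD1 (Ordinal iM)) //= (bigD1 (Ordinal i1M)) /=; last first.
    by rewrite -val_eqE /= gtn_eqF.
  rewrite big1 ?addr0; last first.
    move=> j; rewrite -!val_eqE /= => /andP[/negbTE -> /negbTE ->].
    by rewrite !mul0r.
  rewrite !eqxx orbT !mul1r mulrDr !extremal_entryE // addnS addnn.
  rewrite -[(-1) ^+ i.*2]signr_odd -[(-1) ^+ i.*2.+1]signr_odd /= odd_double.
  rewrite expr0 expr1.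
  have -> : i.+1%:R * q - (h + i%:R * q) = h by rewrite /h -natr1; field.
  have -> : i.+1%:R * q - (h + i.+1%:R * q) = - h by ring.
  have -> : q + i%:R * q = i.+1%:R * q by rewrite -natr1; ring.
  have -> : q + q + i%:R * q = i.+2%:R * q by rewrite -!natr1; ring.
  rewrite sinN; field; rewrite nat1r pnatr_eq0 gt_eqF //.
rewrite (sum_ord_truncate n (fun i => sin (q + i%:R * q) * sin (q + i%:R * q)
      + sin (q + i%:R * q) * sin (q + q + i%:R * q))) ?leqnn ?leqnSn //; last first.
  have -> : q + n%:R * q = n.+1%:R * q by rewrite -natr1; ring.
  by rewrite sin_stepn !mul0r addr0.
rewrite big_split /= !sum_sin_sin // subrr cos0 opprD addNKr cosN sqr_extremal_const.
have -> : cos q = 2 * cos h ^+ 2 - 1.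
  have -> : q = h *+ 2 by rewrite -mulr_natl /h; field.
  by rewrite cos_mulr2n -mulr_natl.
by field; rewrite nat1r pnatr_eq0 !gt_eqF ?cos_half_step_gt0.
Qed.

End SigmaLower.

(** * The Schur norm of [Sigma] over both fields *)

Section SigmaNorm.
Variables (R : realType) (F : comNzRingType) (modulus : F -> R).
Variables (e : {rmorphism R -> F}) (re im : {additive F -> R}).
Hypothesis modulus_ge0 : forall x, 0 <= modulus x.
Hypothesis modulus1 : modulus 1 = 1.
Hypothesis modulusM : forall x y, modulus (x * y) = modulus x * modulus y.
Hypothesis modulusD : forall x y, modulus (x + y) <= modulus x + modulus y.
Hypothesis sqr_modulus : forall x, modulus x ^+ 2 = re x ^+ 2 + im x ^+ 2.
Hypothesis reM : forall r x, re (e r * x) = r * re x.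
Hypothesis imM : forall r x, im (e r * x) = r * im x.

Lemma schur_norm_Sigma (n p : nat) : (n <= p <= n.+1)%N ->
  schur_norm modulus (Sigma F n p) =
  2 / n.+1%:R * (cos (pi / (2 * n.+1%:R)) / sin (pi / (2 * n.+1%:R))).
Proof.
move=> np; have pn : (p <= n.+1)%N by case/andP: np.
have -> : pi / (2 * n.+1%:R) = pi / n.+1%:R / 2 :> R.
  by rewrite [2 * _]mulrC invfM mulrA.
set c := (X in _ = X).
have -> : Sigma F n p = map_mx e (Sigma R n p).
  by apply/matrixP => i j; rewrite !mxE rmorph_nat.
have c0 : 0 <= c.
  rewrite /c -(sum_sqr_Sigma_weight R n); apply: sumr_ge0 => k _; exact: sqr_ge0.
have row_le i : \sum_t Sigma_row R n i t ^+ 2 <= c by rewrite sum_sqr_Sigma_row.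
have col_le j : \sum_t Sigma_col R n p j t ^+ 2 <= c.
  by rewrite sum_sqr_Sigma_col.
apply/eqP; rewrite eq_le; apply/andP; split.
  by apply: (schur_norm_le _ _ _ _ re im _ _ _ _ _ _ _ _ _ _ _
    (Sigma_row R n) (Sigma_col R n p)) => // *; exact: Sigma_factor.
have lower := schur_norm_ge R F modulus e re im modulus_ge0 modulus1 modulusM
  modulusD sqr_modulus reM imM n p (Sigma R n p) c _ _ _
  (Sigma_factor R n p pn) row_le col_le c0.
(* For [n = 0] there are no rows and [c = 0] because [cos (pi/2) = 0]; zero vectors suffice. *)
have [n0|n0] := posnP n.
  apply: (lower 0 (fun=> 0) (fun=> 0) c) => //.
  - by subst n; rewrite [LHS]flatmx0 [RHS]flatmx0.
  - by rewrite big1 // => j _; rewrite expr0n.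
  - by rewrite big1 // => j _; rewrite expr0n.
  - by rewrite big1 /c ?n0 ?divr1 ?cos_pihalf ?mul0r ?mulr0 // => i _; rewrite mul0r.
apply: (lower _ (extremal_col R n) (extremal_row R n) c
  (Sigma_extremal_coisometry R n p np)) => //.
- by rewrite sum_sqr_extremal_col.
- by rewrite sum_sqr_extremal_row.
- by rewrite Sigma_extremal_value.
Qed.

End SigmaNorm.

Theorem theorem4p2 (R : realType) (n : nat) :
  let c : R := 2 / n.+1%:R * (cos (pi / (2 * n.+1%:R)) / sin (pi / (2 * n.+1%:R))) in
  [/\ schur_normR (Sigma R n n) = c,
      schur_normR (Sigma R n n.+1) = c,
      schur_normC (Sigma R[i] n n) = c
    & schur_normC (Sigma R[i] n n.+1) = c].
Proof.
have real_case p : (n <= p <= n.+1)%N -> schur_normR (Sigma R n p) =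
    2 / n.+1%:R * (cos (pi / (2 * n.+1%:R)) / sin (pi / (2 * n.+1%:R))).
  (* Over the reals the imaginary part is the zero map. *)
  apply: (@schur_norm_Sigma R R _ idfun idfun \0) => //=.
  - by rewrite normr1.
  - exact: normrM.
  - exact: ler_normD.
  - by move=> x; rewrite real_normK ?num_real // expr0n addr0.
  - by move=> r x; rewrite mulr0.
have complex_case p : (n <= p <= n.+1)%N -> schur_normC (Sigma R[i] n p) =
    2 / n.+1%:R * (cos (pi / (2 * n.+1%:R)) / sin (pi / (2 * n.+1%:R))).
  apply: (@schur_norm_Sigma R R[i] _ (real_complex R)
    (@complex.Re R) (@complex.Im R)) => //=.
  - by case=> a b; exact: sqrtr_ge0.
  - exact: Normc.normc1.
  - exact: Normc.normcM.
  - exact: le_normcD.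
  - by case=> a b; rewrite /Normc.normc sqr_sqrtr // addr_ge0 ?sqr_ge0.
  - by move=> r [a b] /=; rewrite mul0r subr0.
  - by move=> r [a b] /=; rewrite mul0r addr0.
by split; rewrite ?real_case ?complex_case ?leqnn ?leqnSn.
Qed.
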